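(* For $k=1,\ldots,4$, let $a_k=\frac{m_k}{d_k}$ be rational numbers with $\gcd(m_k,d_k)=1$. Let $p$ be an odd prime with $p\nmid d_1d_2d_3d_4$, and let $q=p^r$, $r\geq 1$, be such that $q\equiv 1\pmod{d}$, where $d=\operatorname{lcm}\{d_1,d_2,d_3,d_4\}$. Then for every $x\in\mathbb{F}_q$, \[ {}_2G_2\left[\begin{array}{cc} a_1, & a_2\\ a_3, & a_4\end{array}\Big| x\right]_q+{}_2G_2\left[\begin{array}{cc} a_1, & a_2\\ a_3, & a_4\end{array}\Big| -x\right]_q ={}_4G_4\left[\begin{array}{cccc} \frac{a_1}{2}, & \frac{1+a_1}{2}, & \frac{a_2}{2}, & \frac{1+a_2}{2}\\ \frac{a_3}{2}, & \frac{1+a_3}{2}, & \frac{a_4}{2}, & \frac{1+a_4}{2}\end{array}\Big| x^2\right]_q. \]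
   Context: Let $p$ be an odd prime, $q=p^r$ with $r\ge 1$, and $\mathbb{F}_q$ the field with $q$ elements. Let $\mathbb{Z}_q$ be the ring of integers of the unramified extension of $\mathbb{Q}_p$ with residue field $\mathbb{F}_q$. Let $\omega:\mathbb{F}_q^\times\to\mathbb{Z}_q^\times$ be the Teichmüller character ($\omega(a)$ is the unique $(q-1)$-th root of unity in $\mathbb{Z}_q$ with $\omega(a)\equiv a\pmod p$), $\overline{\omega}=\omega^{-1}$, and every multiplicative character (including the trivial one and all powers $\overline{\omega}^a$) is extended to $\mathbb{F}_q$ by setting its value at $0$ to be $0$. $\Gamma_p$ denotes Morita's $p$-adic gamma function. For $x\in\mathbb{Q}$, $\lfloor x\rfloor$ is the greatest integer $\le x$ and $\langle x\rangle=x-\lfloor x\rfloor\in[0,1)$. For a positive integer $n$, $a_k,b_k\in\mathbb{Q}\cap\mathbb{Z}_p$ ($1\le k\le n$) and $t\in\mathbb{F}_q$, McCarthy's $p$-adic hypergeometric function is \[ {}_nG_n\left[\begin{array}{ccc} a_1, & \ldots, & a_n\\ b_1, & \ldots, & b_n\end{array}\Big| t\right]_q:=\frac{-1}{q-1}\sum_{a=0}^{q-2}(-1)^{an}\,\overline{\omega}^a(t)\prod_{k=1}^n\prod_{i=0}^{r-1}(-p)^{-\lfloor\langle a_kp^i\rangle-\frac{ap^i}{q-1}\rfloor-\lfloor\langle -b_kp^i\rangle+\frac{ap^i}{q-1}\rfloor}\frac{\Gamma_p(\langle (a_k-\frac{a}{q-1})p^i\rangle)}{\Gamma_p(\langle a_kp^i\rangle)}\frac{\Gamma_p(\langle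 (-b_k+\frac{a}{q-1})p^i\rangle)}{\Gamma_p(\langle -b_kp^i\rangle)}. \] *)

(* Defs.v *)
From HB Require Import structures.
From mathcomp Require Import all_boot all_order all_algebra all_field.
From mathcomp Require Import boolp classical_sets.

Set Implicit Arguments.
Unset Strict Implicit.
Unset Printing Implicit Defensive.

Import Order.TTheory GRing.Theory Num.Theory.
Local Open Scope ring_scope.

(* Z_p is the inverse limit of the Z/p^n: residue x n is the representative in
   [0, p^n) of the class of x mod p^n (the coherence condition alone forces
   this normalization).  The proof of primality is carried by the type so that
   the ring can be canonically an integral domain. *)
Record padic_int (p : nat) (p_pr : prime p) := PadicInt {
  residue :> nat -> int;
  residue_coherent : forall n, (residue n.+1 %% (p ^ n)%:Z)%Z = residue n }.

Section PadicIntRing.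
Variables (p : nat) (p_pr : prime p).
Local Notation Zp := (padic_int p_pr).
Local Notation "'pp' n" := (p ^ n)%N%:Z (at level 8).
Implicit Types (x y z : Zp) (n : nat).

Lemma padic_int_eq x y : (forall n, x n = y n) -> x = y.
Proof.
case: x y => [x hx] [y hy] /= /funext e; case: _ / e hy => hy.
by congr PadicInt; apply: Prop_irrelevance.
Qed.

HB.instance Definition _ := gen_eqMixin Zp.
HB.instance Definition _ := gen_choiceMixin Zp.

Lemma pp_dvd n : (pp n %| pp n.+1)%Z.
Proof. by rewrite dvdzE /= dvdn_exp2l. Qed.

Lemma residue_mod x n : (x n %% pp n)%Z = x n.
Proof. by rewrite -(residue_coherent x n) modz_mod. Qed.

Lemma padic_mk_subproof (f : nat -> int) :
  (forall n, (f n.+1 = f n %[mod pp n])%Z) ->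
  forall n, ((f n.+1 %% pp n.+1)%Z %% pp n)%Z = (f n %% pp n)%Z.
Proof.
move=> hf n; rewrite -(hf n) [in RHS](divz_eq (f n.+1) (pp n.+1)).
by rewrite {3}expnS PoszM mulrA modzMDl.
Qed.

(* The p-adic integer given by a family of integers that is coherent only up to
   congruence. *)
Definition padic_mk f (hf : forall n, (f n.+1 = f n %[mod pp n])%Z) : Zp :=
  PadicInt p_pr (padic_mk_subproof hf).

Lemma residue_step x n : (x n.+1 = x n %[mod pp n])%Z.
Proof. by rewrite residue_coherent residue_mod. Qed.

Fact padic_const_subproof (c : int) n : (c = c %[mod pp n])%Z. Proof. by []. Qed.
Definition padic_const (c : int) : Zp :=
  @padic_mk (fun=> c) (padic_const_subproof c).

Fact padic_opp_subproof x n : (- x n.+1 = - x n %[mod pp n])%Z.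
Proof. by rewrite -modzNm residue_step modzNm. Qed.
Definition padic_opp x : Zp := padic_mk (padic_opp_subproof x).

Fact padic_add_subproof x y n : (x n.+1 + y n.+1 = x n + y n %[mod pp n])%Z.
Proof. by rewrite -modzDm !residue_step modzDm. Qed.
Definition padic_add x y : Zp := padic_mk (padic_add_subproof x y).

Fact padic_mul_subproof x y n : (x n.+1 * y n.+1 = x n * y n %[mod pp n])%Z.
Proof. by rewrite -modzMm !residue_step modzMm. Qed.
Definition padic_mul x y : Zp := padic_mk (padic_mul_subproof x y).

Fact padic_addA : associative padic_add.
Proof. by move=> x y z; apply: padic_int_eq => n /=; rewrite modzDmr modzDml addrA. Qed.
Fact padic_addC : commutative padic_add.
Proof. by move=> x y; apply: padic_int_eq => n /=; rewrite addrC. Qed.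
Fact padic_add0 : left_id (padic_const 0) padic_add.
Proof. by move=> x; apply: padic_int_eq => n /=; rewrite mod0z add0r residue_mod. Qed.
Fact padic_addN : left_inverse (padic_const 0) padic_opp padic_add.
Proof. by move=> x; apply: padic_int_eq => n /=; rewrite modzDml addNr. Qed.

HB.instance Definition _ :=
  GRing.isZmodule.Build Zp padic_addA padic_addC padic_add0 padic_addN.

Fact padic_mulA : associative padic_mul.
Proof. by move=> x y z; apply: padic_int_eq => n /=; rewrite modzMmr modzMml mulrA. Qed.
Fact padic_mulC : commutative padic_mul.
Proof. by move=> x y; apply: padic_int_eq => n /=; rewrite mulrC. Qed.
Fact padic_mul1 : left_id (padic_const 1) padic_mul.
Proof. by move=> x; apply: padic_int_eq => n /=; rewrite modzMml mul1r residue_mod. Qed.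
Fact padic_mulD : left_distributive padic_mul padic_add.
Proof.
by move=> x y z; apply: padic_int_eq => n /=; rewrite modzMml modzDm mulrDl.
Qed.
Fact padic_1neq0 : padic_const 1 != 0 :> Zp.
Proof.
apply/eqP => /(congr1 (fun x : Zp => x 1%N)) /=; rewrite expn1 mod0z.
by rewrite modz_small // lez_nat ltz_nat prime_gt1.
Qed.

HB.instance Definition _ := GRing.Zmodule_isComNzRing.Build Zp
  padic_mulA padic_mulC padic_mul1 padic_mulD padic_1neq0.

Definition padic_unit : pred Zp := fun x => `[< exists y, y * x = 1 >].
Definition padic_inv x : Zp := if padic_unit x then xget x [set y | y * x = 1]
                               else x.

Fact padic_mulV : {in padic_unit, left_inverse 1 padic_inv *%R}.
Proof.
move=> x xu; have xu' : padic_unit x by [].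
by rewrite /padic_inv xu'; case: xgetP => // /forallNP; move/asboolP: xu'.
Qed.
Fact padic_unitP x y : y * x = 1 -> padic_unit x.
Proof. by move=> yx; apply/asboolP; exists y. Qed.
Fact padic_invN : {in [predC padic_unit], padic_inv =1 id}.
Proof. by move=> x xu; rewrite /padic_inv ifN. Qed.

HB.instance Definition _ := GRing.ComNzRing_hasMulInverse.Build Zp
  padic_mulV padic_unitP padic_invN.

Lemma residueD x n k : (x (n + k)%N = x n %[mod pp n])%Z.
Proof.
elim: k => [|k IH]; first by rewrite addn0.
rewrite addnS -{}IH; apply/eqP; rewrite eqz_mod_dvd.
apply: (@dvdz_trans (pp (n + k))); first by rewrite dvdzE /= dvdn_exp2l ?leq_addr.
by rewrite -eqz_mod_dvd residue_step.
Qed.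

Lemma neq0_residue x : x != 0 -> exists n, forall k, ~~ (pp n %| x (n + k)%N)%Z.
Proof.
move=> x0; apply: contrapT => /forallNP h; case/eqP: x0.
apply: padic_int_eq => n /=; rewrite mod0z.
have /existsNP[k /negP] := h n; rewrite negbK => /dvdz_mod0P.
by rewrite residueD residue_mod.
Qed.

Fact padic_mulf_eq0 x y : x * y = 0 -> (x == 0) || (y == 0).
Proof.
apply: contra_eqT; rewrite negb_or => /andP[/neq0_residue[n xn] /neq0_residue[m ym]].
apply/eqP => /(congr1 (fun x : Zp => x (n + m)%N)) /=; rewrite mod0z.
move/dvdz_mod0P; have := xn m; have := ym n; rewrite [(m + n)%N]addnC.
set a := x _; set b := y _; rewrite !dvdzE abszM /= => hb ha.
have gt0 k c : ~~ (p ^ k %| c)%N -> (0 < c)%N by rewrite lt0n; apply: contraNneq => ->; rewrite dvdn0.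
have a0 := gt0 _ _ ha; have b0 := gt0 _ _ hb.
rewrite !pfactor_dvdn ?muln_gt0 ?a0 // in ha hb *.
rewrite lognM // -!ltnNge in ha hb *; rewrite leqNgt.
have : (logn p `|a| + logn p `|b| < n + m)%N by rewrite -addSn leq_add // ltnW.
by move=> ->.
Qed.

HB.instance Definition _ :=
  GRing.ComUnitRing_isIntegral.Build Zp padic_mulf_eq0.

End PadicIntRing.

Section MoritaGamma.
Variables (p : nat) (p_pr : prime p).

Definition morita_gamma_nat (n : nat) : int :=
  (-1) ^+ n * \prod_(1 <= j < n | ~~ (p %| j)%N) j%:Z.

Definition padic_eqmod (N : nat) (x y : padic_int p_pr) : Prop := x N = y N.

(* Gamma_p(x) is the p-adic limit of (-1)^n \prod_(0 < j < n, p \nmid j) j as the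
   natural number n tends p-adically to x; the limit is unique when it exists,
   and it exists for all x when p is odd. *)
Definition morita_gamma (x : padic_int p_pr) : padic_int p_pr :=
  xget 0 [set y : padic_int p_pr | forall N : nat, exists M : nat,
    forall n : nat, padic_eqmod M n%:R x ->
      padic_eqmod N (morita_gamma_nat n)%:~R y].

End MoritaGamma.

Definition frac_part (x : rat) : rat := x - (Num.floor x)%:~R.

Section UnramifiedExtension.
Variables (p : nat) (p_pr : prime p).
Local Notation Zp := (padic_int p_pr).
Variables (K : fieldExtType {fraction Zp}) (F : finFieldType).

Definition of_padic_int (x : Zp) : K := (tofrac x)%:A.

Definition in_integers (x : K) : Prop := integralOver of_padic_int x.

(* K is the unramified extension of Q_p with residue field F: red restricts to a
   surjective ring morphism from the ring of integers of K (the integral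
   closure of Z_p in K) onto F, with kernel generated by p.  The values of red
   outside the ring of integers are irrelevant. *)
Record unramified_reduction (red : K -> F) : Prop := UnramifiedReduction {
  reduction1 : red 1 = 1;
  reductionD : forall x y, in_integers x -> in_integers y -> red (x + y) = red x + red y;
  reductionM : forall x y, in_integers x -> in_integers y -> red (x * y) = red x * red y;
  reduction_surj : forall a, exists2 x, in_integers x & red x = a;
  reduction_ker : forall x, in_integers x ->
    (red x = 0 <-> exists2 y, in_integers y & x = p%:R * y) }.

Variable red : K -> F.

Definition teichmuller (a : F) : K :=
  xget 0 [set w : K | [/\ in_integers w, w ^+ #|F|.-1 = 1 & red w = a]].

(* The character \bar\omega^j of F, extended by 0 at 0 (also for j = 0). *)
Definition omega_bar_pow (j : nat) (t : F) : K :=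
  if t == 0 then 0 else (teichmuller t)^-1 ^+ j.

(* Gamma_p at a rational z, which is meant to have denominator prime to p; ratr
   is then the inclusion of the p-integral rationals in Z_p. *)
Definition gamma_rat (z : rat) : K := of_padic_int (morita_gamma (ratr z : Zp)).

Section HypergeometricG.
Variables (r n : nat) (a b : n.-tuple rat).
Let q := (p ^ r)%N.

Definition G_exponent (k : 'I_n) (i j : nat) : int :=
  let s : rat := j%:R * p%:R ^+ i / (q%:R - 1) in
  - Num.floor (frac_part (tnth a k * p%:R ^+ i) - s)
  - Num.floor (frac_part (- tnth b k * p%:R ^+ i) + s).

Definition G_factor (k : 'I_n) (i j : nat) : K :=
  let s : rat := j%:R / (q%:R - 1) in
  (- p%:R) ^ (G_exponent k i j)
  * (gamma_rat (frac_part ((tnth a k - s) * p%:R ^+ i))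
     / gamma_rat (frac_part (tnth a k * p%:R ^+ i)))
  * (gamma_rat (frac_part ((- tnth b k + s) * p%:R ^+ i))
     / gamma_rat (frac_part (- tnth b k * p%:R ^+ i))).

(* McCarthy's {}_nG_n [a; b | t]_q, q = p^r; the sum is over 0 <= j <= q - 2. *)
Definition mccarthy_G (t : F) : K :=
  -1 / (q%:R - 1) *
  \sum_(0 <= j < q.-1) (-1) ^+ (j * n) * omega_bar_pow j t *
    \prod_(k < n) \prod_(0 <= i < r) G_factor k i j.

End HypergeometricG.

End UnramifiedExtension.

(* Main.v *)
Require Import Defs.
From HB Require Import structures.
From mathcomp Require Import all_boot all_order all_algebra all_field.
From mathcomp Require Import boolp classical_sets.
From mathcomp Require Import zify ring lra.

Set Implicit Arguments.
Unset Strict Implicit.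
Unset Printing Implicit Defensive.

Import Order.TTheory GRing.Theory Num.Theory.
Local Open Scope ring_scope.

(** Write q = p^r and let A(j), C(j) be the coefficients of the 2G2 and of the
   4G4.  Since the character omega-bar is -1 at -1, only even j survive on the
   left, and the right-hand side is summed over omega-bar^(2j)(x), so it is
   enough that C(j) = A(2j) and that A has period q - 1.  The powers of -p agree
   by Hermite's identity floor(z) + floor(z + 1/2) = floor(2z).  For the gamma
   factors put D(x) = Gamma_p(x/2) Gamma_p((x+1)/2) / Gamma_p(x).  The functional
   equation gives D(x + 1) = D(x)/2 for units x and D(x + 1) = D(x) otherwise,
   hence W(y) = D(py)/D(0) is a continuous character with W(1) = 2^(1-p), and
   D(py - c) = 2^c D(py) for 0 <= c < p.  For x = N/(q-1), the fractional parts
   f_i of x p^i satisfy p f_i = f_(i+1) + c_i with digits 0 <= c_i < p, so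
   prod_i D(f_i) = D(0)^r 2^S W(S/(p-1)) = D(0)^r V^S with S = sum_i c_i and
   V = 2 W(1/(p-1)).  As V^(p-1) = 1 and S = N mod p - 1, this is D(0)^r V^N,
   and these powers of V cancel in C(j)/A(2j). *)

(** * The ring of p-adic integers *)

Section PadicIntegers.
Variables (p : nat) (p_pr : prime p).
Local Notation Zp := (padic_int p_pr).
Local Notation "'pp' n" := (p ^ n)%N%:Z (at level 8).
Implicit Types (x y z : Zp) (n N : nat).

Lemma residueDE x y N : (x + y) N = ((x N + y N) %% pp N)%Z. Proof. by []. Qed.
Lemma residueME x y N : (x * y) N = ((x N * y N) %% pp N)%Z. Proof. by []. Qed.
Lemma residueNE x N : (- x) N = ((- x N) %% pp N)%Z. Proof. by []. Qed.
Lemma residue0E N : (0 : Zp) N = 0. Proof. by rewrite /= mod0z. Qed.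
Lemma residue1E N : (1 : Zp) N = (1 %% pp N)%Z. Proof. by []. Qed.

Lemma residue_nat (k N : nat) : (k%:R : Zp) N = (k%:Z %% pp N)%Z.
Proof.
elim: k => [|k IH]; first by rewrite residue0E mod0z.
by rewrite -natr1 residueDE IH residue1E modzDm -addn1 PoszD.
Qed.

Lemma residue_int (c : int) N : (c%:~R : Zp) N = (c %% pp N)%Z.
Proof.
case: c => k; first exact: residue_nat.
by rewrite NegzE mulrNz residueNE residue_nat modzNm.
Qed.

Lemma eqmod_int (c d : int) N :
  padic_eqmod N (c%:~R : Zp) d%:~R <-> (c = d %[mod pp N])%Z.
Proof. by rewrite /padic_eqmod !residue_int. Qed.

Lemma eqmodD N x x' y y' : padic_eqmod N x x' -> padic_eqmod N y y' ->
  padic_eqmod N (x + y) (x' + y').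
Proof. by rewrite /padic_eqmod !residueDE => -> ->. Qed.

Lemma eqmodM N x x' y y' : padic_eqmod N x x' -> padic_eqmod N y y' ->
  padic_eqmod N (x * y) (x' * y').
Proof. by rewrite /padic_eqmod !residueME => -> ->. Qed.

Lemma eqmodN N x x' : padic_eqmod N x x' -> padic_eqmod N (- x) (- x').
Proof. by rewrite /padic_eqmod !residueNE => ->. Qed.

Lemma eqmodW N M x y : (M <= N)%N -> padic_eqmod N x y -> padic_eqmod M x y.
Proof.
move=> /subnKC <- h.
by rewrite /padic_eqmod -(residue_mod x) -(residue_mod y)
           -(residueD x _ (N - M)) -(residueD y _ (N - M)) h.
Qed.

Lemma padic_eqP x y : (forall N, padic_eqmod N x y) -> x = y.
Proof. exact: padic_int_eq. Qed.

Lemma residue_ge0 x N : 0 <= x N.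
Proof. by rewrite -residue_mod modz_ge0 // -lt0n expn_gt0 prime_gt0. Qed.

Lemma padic_approx x N : exists n : nat, padic_eqmod N n%:R x.
Proof.
exists `|x N|%N; rewrite /padic_eqmod residue_nat gez0_abs ?residue_ge0 //.
exact: residue_mod.
Qed.

Lemma residue1_dvd x N : (p%:Z %| x N.+1)%Z = (x 1 == 0).
Proof.
have := residueD x 1 N; rewrite residue_mod expn1 add1n => <-.
exact/dvdz_mod0P/eqP.
Qed.

(** A residue nonzero mod p is invertible mod every p^n by Bezout. The inverses [f n] are chosen
    independently; they cohere because an inverse mod p^n is unique. *)
Lemma padic_unitE x : (x \is a GRing.unit) = (x 1 != 0).
Proof.
apply/idP/idP => [xu|x1].
  apply/eqP => x1; have := residueME x x^-1 1; rewrite mulrV // x1 mul0r mod0z.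
  rewrite residue1E expn1 modz_small ?lez_nat ?ltz_nat ?prime_gt1 //.
have co n : exists u : int, (u * x n = 1 %[mod pp n])%Z.
  have : coprimez (x n) (pp n).
    case: n => [|n]; first by rewrite expn0 coprimezE coprimen1.
    rewrite coprimezE /= coprimeXr // coprime_sym prime_coprime //.
    by rewrite -[p]/(`|p%:Z|%N) -dvdzE residue1_dvd.
  case/coprimezP=> [[u v] /= e]; exists u.
  by rewrite -e addrC modzMDl.
have [f fP] := boolp.choice co.
have coh n : (f n.+1 = f n %[mod pp n])%Z.
  have e1 : (f n.+1 * x n = 1 %[mod pp n])%Z.
    rewrite -modzMmr -(residue_mod x n) -(residue_step x n) modz_mod modzMmr.
    move: (fP n.+1) => /eqP; rewrite eqz_mod_dvd => /(dvdz_trans (pp_dvd p n)).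
    by rewrite -eqz_mod_dvd => /eqP.
  rewrite -[in LHS](mulr1 (f n.+1)) -modzMmr -(fP n) modzMmr mulrCA -modzMmr e1.
  by rewrite modzMmr mulr1.
apply/unitrP; exists (padic_mk p_pr coh).
suff e : padic_mk p_pr coh * x = 1 by rewrite [x * _]mulrC.
by apply: padic_eqP => N; rewrite /padic_eqmod residueME /= modzMml fP.
Qed.

Lemma padic_unit_eqmod x y : padic_eqmod 1 x y ->
  (x \is a GRing.unit) = (y \is a GRing.unit).
Proof. by rewrite !padic_unitE => ->. Qed.

Lemma padic_unit_int (c : int) : ((c%:~R : Zp) \is a GRing.unit) = ~~ (p%:Z %| c)%Z.
Proof. by rewrite padic_unitE residue_int expn1; congr (~~ _); apply/eqP/dvdz_mod0P. Qed.

Lemma padic_unit_nat (k : nat) : ((k%:R : Zp) \is a GRing.unit) = ~~ (p %| k)%N.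
Proof. exact: (padic_unit_int k). Qed.

Lemma padic_unit_neq0 x : x \is a GRing.unit -> x != 0.
Proof. by apply: contraTneq => ->; rewrite unitr0. Qed.

Lemma eqmodV N x y : x \is a GRing.unit -> y \is a GRing.unit ->
  padic_eqmod N x y -> padic_eqmod N x^-1 y^-1.
Proof.
move=> xu yu e; have := eqmodM (eqmodM (erefl (x^-1 N)) (esym e)) (erefl (y^-1 N)).
by rewrite mulVr // mul1r -mulrA mulrV // mulr1 => /esym.
Qed.

(** Dividing by p costs one level of precision, so level n of the quotient is read off from
    [x n.+1]. *)
Lemma nunitP x : x \isn't a GRing.unit -> exists y, x = p%:R * y.
Proof.
rewrite padic_unitE negbK => x1.
have dv n : (p%:Z %| x n.+1)%Z by rewrite residue1_dvd.
have p0 : p%:Z != 0 by rewrite -lt0n prime_gt0.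
have coh n : ((x n.+2 %/ p%:Z)%Z = (x n.+1 %/ p%:Z)%Z %[mod pp n])%Z.
  apply/eqP; rewrite eqz_mod_dvd -(@dvdz_mul2r p%:Z) //.
  rewrite mulrBl !divzK // -PoszM -expnSr -eqz_mod_dvd.
  by rewrite residue_step.
exists (padic_mk p_pr coh); apply: padic_eqP => N; rewrite /padic_eqmod residueME residue_nat.
rewrite modzMml /= modzMmr mulrC divzK //.
by rewrite residue_step residue_mod.
Qed.

Lemma pnat_neq0 : p%:R != 0 :> Zp.
Proof.
apply/eqP => /(congr1 (fun x : Zp => x 2)); rewrite residue_nat residue0E.
by rewrite modz_small ?lez_nat ?ltz_nat //= => [[]|]; have := prime_gt1 p_pr; [lia|rewrite -mulnn; nia].
Qed.

(** Induction on a level at which x has nonzero residue: a nonunit gives up a factor p and lowers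
    that level by one, until a unit is reached. *)
Lemma padic_dvd_pX x : x != 0 -> exists (n : nat) y, x * y = p%:R ^+ n.
Proof.
move=> /neq0_residue[n]; move/(_ 0); rewrite addn0.
elim: n x => [|n IH] x; first by rewrite expn0 dvd1z.
have [xu _|xn] := boolP (x \is a GRing.unit).
  by exists 0, x^-1; rewrite mulrV.
have [y ->] := nunitP xn => h.
have /IH[m [z e]] : ~~ (pp n %| y n)%Z.
  apply: contra h => h; rewrite residueME residue_nat modzMml.
  apply/dvdz_mod0P; rewrite modz_mod; apply/dvdz_mod0P.
  have -> : y n.+1 = y n + (y n.+1 - y n) by ring.
  rewrite mulrDr expnS PoszM rpredD // dvdz_mul //.
  by rewrite -eqz_mod_dvd residue_step.
by exists m.+1, z; rewrite exprS -mulrA e.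
Qed.

(** [ratr] divides by the reduced denominator, which divides d and is therefore a unit of Z_p. *)
Lemma ratr_frac (c : int) (d : nat) : ~~ (p %| d)%N ->
  (ratr (c%:~R / d%:R) : Zp) = c%:~R / d%:R.
Proof.
move=> pd; have d0 : (d%:R : rat) != 0.
  by rewrite pnatr_eq0; apply: contraNneq pd => ->; rewrite dvdn0.
set x : rat := _ / _.
have e : numq x * d%:Z = c * denq x.
  apply: (@intr_inj rat); rewrite !rmorphM /=; have := divq_num_den x.
  move: (denq_neq0 x); rewrite -(intr_eq0 rat) => dx0 ex.
  have en : (numq x)%:~R = x * (denq x)%:~R by rewrite -{2}ex divfK.
  have <- : x * d%:R = c%:~R by rewrite /x divfK.
  by rewrite en -pmulrn mulrAC.
have dd : (denq x %| d%:Z)%Z.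
  rewrite -(@Gauss_dvdzr _ (numq x)) ?e ?dvdz_mull //.
  by rewrite coprimezE coprime_sym coprime_num_den.
have du : ((denq x)%:~R : Zp) \is a GRing.unit.
  by rewrite padic_unit_int; apply: contra pd => /dvdz_trans/(_ dd).
have du' : (d%:R : Zp) \is a GRing.unit by rewrite padic_unit_nat.
rewrite /ratr; apply: (mulIr du'); rewrite divrK //; apply: (mulIr du).
by rewrite mulrAC divrK // [d%:R]pmulrn -!rmorphM /= e.
Qed.

End PadicIntegers.

(** * Morita's p-adic gamma function *)

Section GammaNat.
Variables (p : nat) (p_pr : prime p) (p_odd : odd p).
Local Notation "'pp' n" := (p ^ n)%N%:Z (at level 8).

Lemma morita_gamma_natS n : morita_gamma_nat p n.+1 =
  - (if (p %| n)%N then 1 else n%:Z) * morita_gamma_nat p n.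
Proof.
rewrite /morita_gamma_nat big_mkcond [in RHS]big_mkcond /= exprS -!mulrA !mulN1r mulNr.
congr (- _); case: n => [|n]; first by rewrite dvdn0 !big_geq ?mul1r.
by rewrite big_nat_recr //= [RHS]mulrCA if_neg [X in _ * X = _]mulrC.
Qed.

(** Each block of p consecutive integers contributes (p-1)!, which is -1 mod p by Wilson's
    theorem. *)
Lemma prod_units_pblock k :
  (\prod_(0 <= j < (k * p)%N | ~~ (p %| j)%N) j%:Z = (-1) ^+ k %[mod p])%Z.
Proof.
rewrite big_mkcond.
pose f j : int := if ~~ (p %| j)%N then j%:Z else 1.
rewrite (eq_bigr f) //; elim: k => [|k IH]; first by rewrite big_geq.
have step m : (m < p)%N ->
    (\prod_(0 <= j < (k * p + m).+1) f j = (-1) ^+ k * m`!%:Z %[mod p])%Z.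
  elim: m => [|m IHm] mp; rewrite big_nat_recr //= /f.
    by rewrite addn0 dvdn_mull // !mulr1.
  have -> : (p %| k * p + m.+1)%N = false.
    by rewrite dvdn_addr ?dvdn_mull //; apply/negP => /dvdn_leq; lia.
  rewrite addnS -modzMm IHm ?(ltnW mp) //= modzMml.
  rewrite -modzMmr modz_mod -addnS PoszD PoszM modzMDl modzMmr.
  by rewrite factS mulnC PoszM mulrA.
have p1 := prednK (prime_gt0 p_pr).
rewrite mulSn addnC -{2}p1 addnS step ?p1 // exprSr -modzMmr -[in RHS]modzMmr.
congr ((_ * _) %% _)%Z; apply/eqP; rewrite eqz_mod_dvd opprK dvdzE /= addn1.
by rewrite -Wilson // prime_gt1.
Qed.

(** Inversion permutes the units, so P is also the product of their inverses. *)
Lemma prod_units_square m (P := \prod_(i : 'I_m.+2 | i \is a GRing.unit) i) :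
  P * P = 1.
Proof.
rewrite {1}/P (reindex_inj invr_inj) /=.
under eq_bigl do rewrite unitrV.
rewrite /P -big_split /= big1 // => i iu; exact: mulVr.
Qed.

(* The product of the units of Z/p^N squares to 1 and is -1 mod p. *)
Lemma prod_units_pX N : (0 < N)%N ->
  (\prod_(0 <= j < p ^ N | ~~ (p %| j)%N) j%:Z = -1 %[mod pp N])%Z.
Proof.
move=> N0; set P := \prod_(_ <= _ < _ | _) _.
have Pp : (p%:Z %| P + 1)%Z.
  have := prod_units_pblock (p ^ N.-1); rewrite -expnSr prednK // -/P.
  rewrite -signr_odd oddX p_odd orbT expr1 => /eqP.
  by rewrite eqz_mod_dvd opprK.
have pN1 : (1 < p ^ N)%N by rewrite -(expn0 p) ltn_exp2l ?prime_gt1.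
have P2 : (pp N %| (P - 1) * (P + 1))%Z.
  have -> : (P - 1) * (P + 1) = P * P - 1 by ring.
  (* The shape m + 2 of the modulus gives the ordinals their structure of nontrivial ring. *)
  have [m em] : exists m, (p ^ N = m.+2)%N.
    by exists (p ^ N).-2; move: pN1; case: (p ^ N)%N => [|[]].
  have := prod_units_square m; set P' := \prod_(i | _) _ => P'E.
  have castE : P%:~R = P' :> 'I_m.+2.
    rewrite rmorph_prod /= em big_mkord /P'; apply: eq_big => i.
      have := @unitZpE m.+2 i isT; rewrite -[X in X \is a _]/(i%:R : 'I_m.+2).
      rewrite (natr_Zp (i : 'Z_m.+2)) => ->.
      by move: (@coprime_pexpl N p i N0); rewrite em => ->; rewrite prime_coprime.
    by move=> _; exact: (natr_Zp (i : 'Z_m.+2)).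
  have : (P * P - 1)%:~R = 0 :> 'I_m.+2 by rewrite rmorphB rmorphM /= castE P'E subrr.
  rewrite em; move: (P * P - 1) => X.
  have natP k : k%:R = 0 :> 'I_m.+2 -> (m.+2 %| k)%N.
    by move=> /(congr1 val); rewrite /= (@val_Zp_nat m.+2) // => /eqP.
  case: X => k; first exact: natP.
  by rewrite NegzE rmorphN /= => /eqP; rewrite oppr_eq0 dvdzE /= => /eqP /natP.
(* As p divides P + 1 and p > 2, it does not divide P - 1, so all of p^N divides P + 1. *)
rewrite mulrC Gauss_dvdzl in P2.
  by apply/eqP; rewrite eqz_mod_dvd opprK.
rewrite coprimezE /= coprimeXl // prime_coprime //.
rewrite -[p]/(`|p%:Z|%N) -dvdzE; apply/negP => h.
have := rpredB Pp h; have -> : P + 1 - (P - 1) = 2 by ring.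
rewrite dvdzE /= => /dvdn_leq p2; have := prime_gt1 p_pr.
by move: p_odd (p2 isT); clear; case: p => [|[|[|n]]].
Qed.

(** At n = 0 the sign (-1)^(p^N) = -1 cancels the product -1 of the units; the recursion in n
    depends only on n mod p^N. *)
Lemma morita_gamma_natD N n : (0 < N)%N ->
  (morita_gamma_nat p (n + p ^ N) = morita_gamma_nat p n %[mod pp N])%Z.
Proof.
move=> N0; elim: n => [|n IH].
  rewrite /morita_gamma_nat add0n -signr_odd oddX p_odd orbT expr1 mulN1r.
  rewrite [in RHS]big_geq // mulr1 -modzNm.
  have := prod_units_pX N0.
  rewrite big_ltn_cond ?expn_gt0 ?prime_gt0 // dvdn0 /= => ->.
  by rewrite modzNm opprK.
rewrite addSn !morita_gamma_natS -modzMmr IH modzMmr dvdn_addl ?dvdn_exp //.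
case: ifP => // _; rewrite PoszD -[in LHS]modzMml -[(- (_ + _))%R in LHS]mulN1r.
by rewrite mulrDr mulN1r addrC modzMDl modzMml.
Qed.

End GammaNat.

Section MoritaGammaTheory.
Variables (p : nat) (p_pr : prime p) (p_odd : odd p).
Local Notation Zp := (padic_int p_pr).
Local Notation "'pp' n" := (p ^ n)%N%:Z (at level 8).
Local Notation Gamma := (@morita_gamma p p_pr).
Implicit Types (x y z : Zp) (n N : nat).

Lemma morita_gamma_nat_mod N m n : (m = n %[mod p ^ N])%N ->
  (morita_gamma_nat p m = morita_gamma_nat p n %[mod pp N])%Z.
Proof.
case: N => [|N]; first by rewrite expn0 !modz1.
move=> e; rewrite (divn_eq m (p ^ N.+1)) (divn_eq n (p ^ N.+1)) e.
suff modE k l : (morita_gamma_nat p (k * p ^ N.+1 + l) = morita_gamma_nat p l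
  %[mod pp N.+1])%Z by rewrite !modE.
elim: k => // k <-; rewrite mulSn -addnA addnC.
exact: morita_gamma_natD.
Qed.

(** If a limit exists, it is compared with an m close to x at both levels M and N. Otherwise the
    values at the residues of x form a coherent family that is a limit, a contradiction. Level N of
    the argument thus determines level N of the value. *)
Lemma morita_gamma_approx x n N : padic_eqmod N n%:R x ->
  padic_eqmod N (morita_gamma_nat p n)%:~R (Gamma x).
Proof.
move=> nx; rewrite /morita_gamma; case: xgetP => [y _ yP|].
  have [M MP] := yP N; have [m mx] := padic_approx x (maxn M N).
  have := MP m (eqmodW (leq_maxl M N) mx); rewrite /padic_eqmod => <-.
  apply/eqmod_int/morita_gamma_nat_mod.
  have : padic_eqmod N n%:R (m%:R : Zp) := etrans nx (esym (eqmodW (leq_maxr M N) mx)).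
  by rewrite /padic_eqmod !residue_nat !modz_nat => -[].
pose f N := morita_gamma_nat p `|x N|%N.
have coh k : (f k.+1 = f k %[mod pp k])%Z.
  apply: morita_gamma_nat_mod; apply: (can_inj absz_nat).
  by rewrite -!modz_nat !gez0_abs ?residue_ge0 // residue_step.
move=> noy; case: (noy (padic_mk p_pr coh)) => k; exists k => m.
rewrite /padic_eqmod residue_nat residue_int /= => e.
apply/morita_gamma_nat_mod/(can_inj absz_nat).
by rewrite -!modz_nat gez0_abs ?residue_ge0 // residue_mod -e.
Qed.

Lemma morita_gamma_eqmod N x y :
  padic_eqmod N x y -> padic_eqmod N (Gamma x) (Gamma y).
Proof.
move=> xy; have [n nx] := padic_approx x N.
exact: etrans (esym (morita_gamma_approx nx)) (morita_gamma_approx (etrans nx xy)).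
Qed.

Lemma morita_gammaS x :
  Gamma (x + 1) = - (if x \is a GRing.unit then x else 1) * Gamma x.
Proof.
apply: padic_eqP => N; have [n nx] := padic_approx x N.+1.
(* Working at level N + 1 guarantees level at least 1, which decides whether x is a unit. *)
apply: (@eqmodW _ _ N.+1) => //.
have nx1 : padic_eqmod N.+1 n.+1%:R (x + 1) by rewrite -natr1; apply: eqmodD.
apply: etrans (esym (morita_gamma_approx nx1)) _; rewrite morita_gamma_natS intrM.
apply: eqmodM; last exact: morita_gamma_approx.
rewrite -(padic_unit_eqmod (eqmodW _ nx)) // padic_unit_nat mulrNz.
by apply: eqmodN; case: ifP => _ //; exact: nx.
Qed.

Lemma morita_gamma_unit x : Gamma x \is a GRing.unit.
Proof.
have [n nx] := padic_approx x 1.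
rewrite -(padic_unit_eqmod (morita_gamma_approx nx)).
elim: n {nx} => [|n IH]; first by rewrite /morita_gamma_nat big_geq // unitr1.
rewrite morita_gamma_natS intrM unitrMl //.
rewrite mulrNz unitrN; case: ifP => [_|pn]; first exact: unitr1.
by rewrite padic_unit_nat pn.
Qed.

End MoritaGammaTheory.

(** * The duplication formula *)

Section Duplication.
Variables (p : nat) (p_pr : prime p) (p_odd : odd p).
Local Notation Zp := (padic_int p_pr).
Local Notation Gamma := (@morita_gamma p p_pr).
Implicit Types (x y z : Zp) (n N : nat).

(** The function D of the overview. *)
Definition dup_ratio x : Zp := Gamma (x / 2) * Gamma ((x + 1) / 2) / Gamma x.

Lemma padic_unit2 : (2 : Zp) \is a GRing.unit.
Proof.
rewrite padic_unit_nat; apply/negP => /dvdn_leq p2; have := prime_gt1 p_pr.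
by move: p_odd (p2 isT); clear; case: p => [|[|[|n]]].
Qed.

Lemma padic_unit_predp : (p.-1%:R : Zp) \is a GRing.unit.
Proof.
rewrite padic_unit_nat; apply/negP => /dvdn_leq.
by have := prime_gt1 p_pr; lia.
Qed.

Lemma dup_ratio_unit x : dup_ratio x \is a GRing.unit.
Proof. by rewrite unitrMl ?unitrV ?unitrMl ?morita_gamma_unit. Qed.

Lemma dup_ratio_eqmod N x y :
  padic_eqmod N x y -> padic_eqmod N (dup_ratio x) (dup_ratio y).
Proof.
move=> xy; apply: eqmodM; last first.
  by apply: eqmodV; rewrite ?morita_gamma_unit //; apply: morita_gamma_eqmod.
by apply: eqmodM; apply: morita_gamma_eqmod => //; apply: eqmodM => //; apply: eqmodD.
Qed.

(** The step x to x + 1 exchanges the two half arguments except that x/2 becomes x/2 + 1. The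
    functional equations at x/2 and at x leave the quotient of x/2 by x, or 1 for nonunits; the
    signs cancel. *)
Lemma dup_ratioS x :
  dup_ratio x = (if x \is a GRing.unit then 2 else 1) * dup_ratio (x + 1).
Proof.
have xu2 : (x / 2 \is a GRing.unit) = (x \is a GRing.unit).
  by rewrite unitrM unitrV padic_unit2 andbT.
have e2 : (x + 1 + 1) / 2 = x / 2 + 1 by rewrite -addrA mulrDl divrr ?padic_unit2.
rewrite /dup_ratio e2 !morita_gammaS // xu2.
set a := Gamma (x / 2); set b := Gamma _; set c := Gamma x.
set e := if _ then 2 else _; set s := if _ then x / 2 else _; set d := if _ then x else _.
have cu : c \is a GRing.unit := morita_gamma_unit p_odd x.
have du : - d * c \is a GRing.unit.
  by rewrite unitrM cu unitrN andbT /d; case: ifP => //; rewrite unitr1.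
have des : d = e * s.
  by rewrite /d /e /s; case: ifP => _; rewrite ?mul1r // mulrC divrK ?padic_unit2.
apply: (mulIr du); rewrite -[RHS]mulrA divrK // [LHS]mulrCA divrK //.
by rewrite [in LHS]des; ring.
Qed.

(** All p y - k with 0 < k < p are units, so each of the c steps up to p y gives a factor 2. *)
Lemma dup_ratio_mulpB c y : (c < p)%N ->
  dup_ratio (p%:R * y - c%:R) = 2 ^+ c * dup_ratio (p%:R * y).
Proof.
elim: c => [|c IH] cp; first by rewrite subr0 mul1r.
rewrite dup_ratioS exprS -mulrA -IH ?(ltnW cp) // -natr1 opprD addrA subrK.
suff -> : p%:R * y - c%:R - 1 \is a GRing.unit by [].
have -> : p%:R * y - c%:R - 1 = p%:R * y - c.+1%:R by rewrite -natr1 opprD addrA.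
have e : padic_eqmod 1 (p%:R * y - c.+1%:R) (- c.+1%:R).
  rewrite -[X in padic_eqmod _ _ X]add0r; apply: eqmodD => //.
  by rewrite -[0](mul0r y); apply: eqmodM => //; rewrite /padic_eqmod residue_nat modzz residue0E.
rewrite (padic_unit_eqmod e) unitrN padic_unit_nat.
by apply/negP => /dvdn_leq; lia.
Qed.

Definition dup_char y : Zp := dup_ratio (p%:R * y) / dup_ratio 0.

Lemma dup_char0 : dup_char 0 = 1.
Proof. by rewrite /dup_char mulr0 divrr ?dup_ratio_unit. Qed.

(** Among the p unit steps from p y to p y + p, only the first starts at a nonunit; the other p - 1
    give a factor 2 each. *)
Lemma dup_charS y : 2 ^+ p.-1 * dup_char (y + 1) = dup_char y.
Proof.
have p0 := prime_gt0 p_pr.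
rewrite /dup_char mulrA -dup_ratio_mulpB ?prednK //; congr (_ / _).
have -> : p%:R * (y + 1) - p.-1%:R = p%:R * y + 1.
  have pE : p%:R = p.-1%:R + 1 :> Zp by rewrite natr1 prednK.
  by rewrite mulrDr mulr1 [X in _ + X - _]pE; ring.
have /negPf pyu : p%:R * y \isn't a GRing.unit.
  by rewrite unitrM padic_unit_nat dvdnn.
by rewrite [RHS]dup_ratioS pyu mul1r.
Qed.

(** Iterating [dup_charS] gives the case of a natural number z; density and continuity give the
    rest. *)
Lemma dup_charD y z : dup_char (y + z) = dup_char y * dup_char z.
Proof.
have natE n x : (2 ^+ p.-1) ^+ n * dup_char (x + n%:R) = dup_char x.
  elim: n x => [|n IH] x; first by rewrite mul1r addr0.
  by rewrite exprSr -mulrA -[n.+1%:R]natr1 addrA dup_charS IH.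
have tu n : (2 ^+ p.-1 : Zp) ^+ n \is a GRing.unit by rewrite !unitrX ?padic_unit2.
have natD n : dup_char (y + n%:R) = dup_char y * dup_char n%:R.
  apply: (mulrI (tu n)); rewrite natE mulrCA.
  by have := natE n 0; rewrite add0r dup_char0 => ->; rewrite mulr1.
have char_eqmod N u v : padic_eqmod N u v -> padic_eqmod N (dup_char u) (dup_char v).
  by move=> uv; apply: eqmodM => //; apply: dup_ratio_eqmod; apply: eqmodM.
apply: padic_eqP => N; have [n nz] := padic_approx z N.
have := char_eqmod _ _ _ (eqmodD (erefl (y N)) nz); rewrite natD => e.
apply: etrans (esym e) _; apply: eqmodM => //.
exact: char_eqmod.
Qed.

Lemma dup_charMn y n : dup_char (y *+ n) = dup_char y ^+ n.
Proof. by elim: n => [|n IH]; rewrite ?dup_char0 // mulrS dup_charD IH exprS. Qed.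

(* [dup_char y] stands for 2 ^ ((1 - p) y), so this is the Teichmuller
   representative of 2. *)
Definition dup_root : Zp := 2 * dup_char (p.-1%:R)^-1.

Lemma dup_root_expp : dup_root ^+ p.-1 = 1.
Proof.
rewrite exprMn -dup_charMn -[_^-1 *+ _]mulr_natr mulVr ?padic_unit_predp //.
by have := dup_charS 0; rewrite add0r dup_char0.
Qed.

Lemma dup_root_unit : dup_root \is a GRing.unit.
Proof.
rewrite -(@unitrX_pos _ _ p.-1) ?dup_root_expp ?unitr1 //.
by have := prime_gt1 p_pr; lia.
Qed.

(** Since f(i+1) = p f(i) - c(i), the ratio at f(i+1) is 2^c(i) D(0) W(f(i)). As f closes up after r
    steps, the product may be taken over the f(i+1), and W turns it into a value at the sum of the
    f(i). *)
Lemma prod_dup_ratio (r : nat) (f : nat -> Zp) (c : nat -> nat) :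
  (forall i, (c i < p)%N) -> (forall i, p%:R * f i = f i.+1 + (c i)%:R) ->
  f r = f 0%N ->
  \prod_(i < r) dup_ratio (f i) = dup_ratio 0 ^+ r * dup_root ^+ (\sum_(i < r) c i).
Proof.
move=> cp fS fr.
have sumS : \sum_(i < r) f i.+1 = \sum_(i < r) f i.
  have := erefl (\sum_(i < r.+1) f i).
  rewrite {1}big_ord_recl big_ord_recr /= fr [RHS]addrC => e.
  by apply: (addrI (f 0%N)); exact: e.
have -> : \prod_(i < r) dup_ratio (f i) = \prod_(i < r) dup_ratio (f i.+1).
  have := erefl (\prod_(i < r.+1) dup_ratio (f i)).
  rewrite {1}big_ord_recr big_ord_recl /= fr [LHS]mulrC => e.
  by apply: (mulrI (dup_ratio_unit (f 0%N))); exact: e.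
(* Summing p f(i) = f(i+1) + c(i) around the cycle. *)
have e : p.-1%:R * \sum_(i < r) f i = (\sum_(i < r) c i)%:R.
  rewrite natr_sum; apply: (addrI (\sum_(i < r) f i)).
  have pE : p%:R = 1 + p.-1%:R :> Zp by rewrite nat1r prednK ?prime_gt0.
  rewrite -[X in X + _ = _]mul1r -mulrDl -pE mulr_sumr -[X in _ = X + _]sumS -big_split /=.
  by apply: eq_bigr => i _; rewrite fS.
have -> : dup_root ^+ (\sum_(i < r) c i) =
    2 ^+ (\sum_(i < r) c i) * dup_char (\sum_(i < r) f i).
  rewrite exprMn -dup_charMn -[_^-1 *+ _]mulr_natr -e mulKr ?padic_unit_predp //.
have -> : dup_char (\sum_(i < r) f i) = \prod_(i < r) dup_char (f i).
  exact: (big_morph _ dup_charD dup_char0).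
rewrite expr_sum -big_split -[r in _ ^+ r]card_ord -prodr_const -big_split /=.
apply: eq_bigr => i _.
have -> : f i.+1 = p%:R * f i - (c i)%:R by rewrite fS addrK.
rewrite dup_ratio_mulpB // mulrCA; congr (_ * _).
by rewrite [RHS]mulrC divrK ?dup_ratio_unit.
Qed.

End Duplication.

(** * Duplication at rational arguments with denominator q - 1 *)

Lemma frac_part_int_div (a : int) (d : nat) : (0 < d)%N ->
  frac_part (a%:~R / d%:R) = (a %% d)%Z%:~R / d%:R.
Proof.
move=> d0; have d0' : (0 : rat) < d%:R by rewrite ltr0n.
rewrite /frac_part (@floor_def _ _ (a %/ d)%Z).
  rewrite {1}(divz_eq a d) intrD intrM -[d%:~R]pmulrn mulrDl mulfK ?gt_eqF //.
  by rewrite addrAC subrr add0r.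
rewrite ler_pdivlMr // ltr_pdivrMr // [d%:R]pmulrn -!intrM ler_int ltr_int.
by rewrite lez_floor ?ltz_ceil //; lia.
Qed.

Section DuplicationRational.
Variables (p : nat) (p_pr : prime p) (p_odd : odd p) (r : nat) (r_gt0 : (0 < r)%N).
Local Notation Zp := (padic_int p_pr).
Local Notation Gamma := (@morita_gamma p p_pr).
Let Q := (p ^ r).-1.

Let Q_gt0 : (0 < Q)%N.
Proof. by rewrite /Q -subn1 subn_gt0 -(expn0 p) ltn_exp2l // prime_gt1. Qed.

Let QS : Q.+1 = (p ^ r)%N.
Proof. by rewrite prednK // expn_gt0 prime_gt0. Qed.

Let pQ : ~~ (p %| Q)%N.
Proof.
apply/negP => h; have := dvdn_exp r_gt0 (dvdnn p); rewrite -QS -addn1 dvdn_addr //.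
by rewrite dvdn1 => /eqP p1; have := prime_gt1 p_pr; rewrite p1.
Qed.

Lemma prod_gamma_dup (N : int)
    (f := fun i => frac_part (N%:~R * p%:R ^+ i / Q%:R)) :
  \prod_(i < r) (Gamma (ratr (f i / 2)) * Gamma (ratr ((f i + 1) / 2))) =
  dup_ratio (0 : Zp) ^+ r * dup_root p_pr ^ N * \prod_(i < r) Gamma (ratr (f i)).
Proof.
pose n i := (N * (p ^ i)%N %% Q)%Z.
have fE i : f i = (n i)%:~R / Q%:R.
  by rewrite /f -natrX [_%:R in X in frac_part (X / _)]pmulrn -intrM frac_part_int_div.
have p2Q : ~~ (p %| 2 * Q)%N.
  by rewrite Euclid_dvdM // negb_or pQ andbT -(padic_unit_nat p_pr) padic_unit2.
have Qu : (Q%:R : Zp) \is a GRing.unit by rewrite padic_unit_nat.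
have u2 : (2 : Zp) \is a GRing.unit := padic_unit2 p_pr p_odd.
pose F i : Zp := (n i)%:~R / Q%:R.
have ratr_f i : ratr (f i) = F i by rewrite fE ratr_frac.
have Q0 : (Q%:R : rat) != 0 by rewrite pnatr_eq0 -lt0n.
have ratr_half (m : int) : (ratr (m%:~R / Q%:R / 2) : Zp) = m%:~R / Q%:R / 2.
  rewrite -mulrA -invfM -natrM mulnC ratr_frac // mulnC.
  by rewrite natrM invrM // [_^-1 * _]mulrC mulrA.
have ratr_f1 i : ratr (f i / 2) = F i / 2 by rewrite fE ratr_half.
have ratr_f2 i : ratr ((f i + 1) / 2) = (F i + 1) / 2.
  have -> : f i + 1 = (n i + Q%:Z)%:~R / Q%:R.
    by rewrite fE intrD -[Q%:~R]pmulrn mulrDl divff.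
  by rewrite ratr_half intrD -[Q%:~R]pmulrn mulrDl divrr.
have -> : \prod_(i < r) (Gamma (ratr (f i / 2)) * Gamma (ratr ((f i + 1) / 2))) =
  \prod_(i < r) (dup_ratio (F i) * Gamma (ratr (f i))).
  apply: eq_bigr => i _; rewrite ratr_f1 ratr_f2 ratr_f.
  by rewrite /dup_ratio divrK ?morita_gamma_unit.
rewrite big_split /=; congr (_ * _).
(* The base p digits of n(0)/Q, produced by long division with remainders n(i). *)
pose c i := `|(p%:Z * n i %/ Q)%Z|%N.
have n_ge0 i : 0 <= n i by rewrite modz_ge0 // -lt0n.
have n_lt i : n i < Q by rewrite ltz_pmod.
have cE i : (c i)%:Z = (p%:Z * n i %/ Q)%Z.
  by rewrite gez0_abs // divz_ge0 // mulr_ge0.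
have nS i : p%:Z * n i = (c i)%:Z * Q%:Z + n i.+1.
  rewrite cE {1}(divz_eq (p%:Z * n i) Q); congr (_ + _).
  by rewrite /n modzMmr expnS PoszM mulrCA.
have c_lt i : (c i < p)%N.
  rewrite -ltz_nat cE ltz_divLR // ltr_pM2l // ltz_nat prime_gt0 //.
(* Here p^r = Q + 1 is 1 mod Q. *)
have nr : n r = n 0%N.
  by rewrite /n -QS -addn1 PoszD mulrDr mulrC -[X in (X + _)%R]mulrC modzMDl.
have FS i : p%:R * F i = F i.+1 + (c i)%:R.
  rewrite /F mulrA [p%:R]pmulrn -intrM nS intrD intrM -!pmulrn mulrDl mulrK //.
  by rewrite addrC.
rewrite (prod_dup_ratio p_odd c_lt FS) ?/F ?nr //; congr (_ * _).
(* The digit sum is N mod p - 1: compare (p-1) sum n(i) = Q sum c(i) with n(i) = N p^i - Q floor(N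
   p^i / Q), using Q = (p-1) sum p^i. *)
have S_mod : (\sum_(i < r) c i)%:Z = N - p.-1%:Z * \sum_(i < r) (N * (p ^ i)%N %/ Q)%Z.
  have p1E : p%:Z = p.-1%:Z + 1 by rewrite -PoszD addn1 prednK ?prime_gt0.
  have sumS : \sum_(i < r) n i.+1 = \sum_(i < r) n i.
    have := erefl (\sum_(i < r.+1) n i).
    rewrite {1}big_ord_recl big_ord_recr /= nr [RHS]addrC => e.
    by apply: (addrI (n 0%N)); exact: e.
  have e1 : p.-1%:Z * \sum_(i < r) n i = (\sum_(i < r) c i)%:Z * Q%:Z.
    apply: (addrI (\sum_(i < r) n i)).
    rewrite -{1}[\sum_(i < r) n i]mul1r -mulrDl addrC -p1E mulr_sumr -sumS.
    rewrite -[(\sum_(i < r) c i)%:Z]natz natr_sum mulr_suml -big_split /=.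
    by apply: eq_bigr => i _; rewrite nS natz addrC.
  have e2 : \sum_(i < r) n i =
      N * (\sum_(i < r) p ^ i)%N - (\sum_(i < r) (N * (p ^ i)%N %/ Q)%Z) * Q%:Z.
    rewrite -[(\sum_(i < r) p ^ i)%N%:Z]natz natr_sum mulr_sumr mulr_suml -sumrB.
    by apply: eq_bigr => i _; rewrite natz [X in _ = X - _](divz_eq _ Q%:Z) addrAC subrr add0r.
  have QE : Q%:Z = p.-1%:Z * (\sum_(i < r) p ^ i)%N by rewrite -PoszM -predn_exp.
  apply: (@mulIf _ Q%:Z); first by rewrite -lt0n.
  rewrite -e1 e2 QE; ring.
rewrite -[LHS]/(dup_root p_pr ^ (\sum_(i < r) c i)%:Z) S_mod.
by rewrite exprzDr ?dup_root_unit // -mulrN -exprz_exp -exprnP dup_root_expp // exp1rz mulr1.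
Qed.

End DuplicationRational.

(** * Teichmuller representatives *)

Section PadicSeries.
Variables (p : nat) (p_pr : prime p).
Local Notation Zp := (padic_int p_pr).
Local Notation "'pp' n" := (p ^ n)%N%:Z (at level 8).

Lemma padic_series_subproof (d : nat -> bool) N :
  (\sum_(n < N.+1) (p ^ n * d n)%N%:Z = \sum_(n < N) (p ^ n * d n)%N%:Z
     %[mod pp N])%Z.
Proof. by rewrite big_ord_recr /= PoszM addrC mulrC modzMDl. Qed.

(** The digits are only 0 or 1: d will be the indicator of the places where a sequence in F takes a
    given value. *)
Definition padic_series (d : nat -> bool) : Zp :=
  padic_mk p_pr (padic_series_subproof d).

Lemma padic_series_recl d :
  padic_series d = (d 0%N)%:R + p%:R * padic_series (d \o S).
Proof.
apply: padic_eqP => N; rewrite /padic_eqmod residueDE residueME !residue_nat /=.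
rewrite modzMm modzDm -padic_series_subproof big_ord_recl /= mul1n.
rewrite mulr_sumr; congr ((_ + _) %% _)%Z; apply: eq_bigr => n _.
by rewrite -PoszM mulnA expnS.
Qed.

End PadicSeries.

Section Teichmuller.
Variables (p : nat) (p_pr : prime p).
Local Notation Zp := (padic_int p_pr).
Variables (K : fieldExtType {fraction Zp}) (F : finFieldType) (red : K -> F).
Hypothesis red_unram : unramified_reduction red.
Variables (r : nat) (r_gt0 : (0 < r)%N) (cardF : #|F| = (p ^ r)%N).
Local Notation O := (@in_integers p p_pr K).
Local Notation iota := (@of_padic_int p p_pr K).
Implicit Types (x y z : K).

HB.instance Definition _ :=
  GRing.RMorphism.copy iota (in_alg K \o @tofrac Zp).

Lemma of_padic_int_eq0 a : (iota a == 0) = (a == 0).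
Proof. by rewrite -[iota a]/(in_alg K _) fmorph_eq0 tofrac_eq0. Qed.

Lemma in_integersD x y : O x -> O y -> O (x + y).
Proof. exact: (@integral_add _ _ iota). Qed.
Lemma in_integersN x : O x -> O (- x).
Proof. exact: (@integral_opp _ _ iota). Qed.
Lemma in_integersM x y : O x -> O y -> O (x * y).
Proof. exact: (@integral_mul _ _ iota). Qed.
Lemma in_integers_of a : O (iota a).
Proof. exact: (@integral_id _ _ iota). Qed.
Lemma in_integers_nat n : O n%:R.
Proof. by rewrite -(rmorph_nat iota); apply: in_integers_of. Qed.
Lemma in_integersX x n : O x -> O (x ^+ n).
Proof.
move=> Ox; elim: n => [|n IH]; first exact: (in_integers_nat 1).
by rewrite exprS; apply: in_integersM.
Qed.
Lemma in_integers_sum I (s : seq I) (f : I -> K) :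
  (forall i, O (f i)) -> O (\sum_(i <- s) f i).
Proof.
move=> Of; elim/big_ind: _ => // [|x y]; [exact: (in_integers_nat 0)|exact: in_integersD].
Qed.

Lemma fieldext_p_neq0 : (p%:R : K) != 0.
Proof. by rewrite -(rmorph_nat iota) of_padic_int_eq0 pnat_neq0. Qed.

Lemma reduction0 : red 0 = 0.
Proof.
have O0 := in_integers_nat 0; have := reductionD red_unram O0 O0.
by rewrite addr0 -{1}[red 0]addr0 => /addrI.
Qed.

Lemma reductionN x : O x -> red (- x) = - red x.
Proof.
move=> Ox; apply/eqP; rewrite -addr_eq0 -(reductionD red_unram) ?addNr ?reduction0 //.
exact: in_integersN.
Qed.

Lemma reduction_nat n : red n%:R = n%:R.
Proof.
elim: n => [|n IH]; first exact: reduction0.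
have [On O1] := (in_integers_nat n, in_integers_nat 1).
by rewrite -[in LHS]natr1 (reductionD red_unram On O1) IH (reduction1 red_unram) natr1.
Qed.

Lemma reductionX x n : O x -> red (x ^+ n) = red x ^+ n.
Proof.
move=> Ox; elim: n => [|n IH]; first exact: reduction1.
by rewrite !exprS (reductionM red_unram) ?IH //; apply: in_integersX.
Qed.

Lemma reduction_sum I (s : seq I) (f : I -> K) :
  (forall i, O (f i)) -> red (\sum_(i <- s) f i) = \sum_(i <- s) red (f i).
Proof.
move=> Of; elim: s => [|i s IH]; first by rewrite !big_nil reduction0.
by rewrite !big_cons (reductionD red_unram) ?IH //; apply: in_integers_sum.
Qed.

Lemma reduction_p_mul y : O y -> red (p%:R * y) = 0.
Proof.
move=> Oy; apply/(reduction_ker red_unram); last by exists y.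
by apply: in_integersM => //; apply: in_integers_nat.
Qed.

(** The ideals p^N O replace a topology on K: congruences and limits are expressed through them. *)
Definition pX_integers N x := exists2 y, O y & x = p%:R ^+ N * y.

Lemma pX_integersD N x y : pX_integers N x -> pX_integers N y -> pX_integers N (x + y).
Proof.
move=> [u Ou ->] [v Ov ->]; exists (u + v); rewrite ?mulrDr //.
exact: in_integersD.
Qed.

Lemma pX_integersM N x y : pX_integers N x -> O y -> pX_integers N (x * y).
Proof.
by move=> [u Ou ->] Oy; exists (u * y); rewrite ?mulrA //; apply: in_integersM.
Qed.

(* A nonzero integral element is a root of a monic polynomial with nonzero
   constant term, so it divides a power of p and is not infinitely divisible
   by p. *)
Lemma pX_integers_separated x : (forall N, pX_integers N x) -> x = 0.
Proof.
move=> px; apply: contrapT => /eqP x0.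
have [P Pm Px] : O x by have [y Oy ->] := px 0%N; rewrite mul1r.
(* Removing the highest power of X from P makes the constant term c nonzero, and x, being nonzero,
   stays a root. *)
have [k [Q /implyP/(_ (monic_neq0 Pm)) Q0]] := multiplicity_XsubC P 0.
rewrite subr0 => PE; set c := Q.[0].
have [T TE] : exists T, Q - c%:P = T * 'X.
  have /factor_theorem[T] : root (Q - c%:P) 0 by rewrite /root !hornerE subrr.
  by rewrite subr0; exists T.
pose w := (map_poly iota T).[x].
have Ow : O w.
  apply: (integral_horner (RtoK := iota)); last by exists P.
  by apply/integral_poly => i; rewrite coef_map; apply: integral_id.
have cE : iota c = - (x * w).
  apply/eqP; rewrite -addr_eq0; apply/eqP.
  have : root (map_poly iota Q) x.
    have : root (map_poly iota P) x := Px.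
    rewrite PE rmorphM rmorphXn /= map_polyX rootM => /orP[//|].
    by rewrite /root hornerXn expf_eq0 (negPf x0) andbF.
  have -> : Q = c%:P + T * 'X by rewrite -TE addrC subrK.
  by rewrite rmorphD rmorphM /= map_polyC map_polyX /root !hornerE => /eqP <-; rewrite mulrC.
(* With c e = p^m and x = p^(m+1) v, the relation c = - x w becomes 1 + p v w e = 0, whose reduction
   is 1 = 0. *)
have [m [e ce]] := padic_dvd_pX Q0.
have [v Ov xv] := px m.+1.
have : p%:R ^+ m * (1 + p%:R * (v * w * iota e)) = 0 :> K.
  have : iota (c * e) = p%:R ^+ m.
    by rewrite ce rmorphXn /= rmorph_nat.
  by rewrite rmorphM /= cE xv => ie; rewrite mulrDr mulr1 -{1}ie exprSr; ring.
move/eqP; rewrite mulf_eq0 expf_eq0 (negPf fieldext_p_neq0) andbF /= => /eqP e0.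
have Oy : O (v * w * iota e) by apply: in_integersM (in_integers_of _); apply: in_integersM.
have := congr1 red e0; rewrite reduction0 (reductionD red_unram); last first.
- by apply: in_integersM => //; apply: in_integers_nat.
- exact: (in_integers_nat 1).
by rewrite (reduction1 red_unram) reduction_p_mul // addr0 => /eqP; rewrite oner_eq0.
Qed.

(** The cofactor of x - y in x^q - y^q reduces to q times a power of [red y], which is 0 in F, so it
    supplies one more factor p. *)
Lemma pX_integers_expq N x y : O x -> O y -> red x = red y ->
  pX_integers N (x - y) -> pX_integers N.+1 (x ^+ #|F| - y ^+ #|F|).
Proof.
move=> Ox Oy rxy pxy; rewrite cardF subrXX.
set s := \sum_(i < _) _.
have Os : O s.
  by apply: in_integers_sum => i; apply: in_integersM; apply: in_integersX.
have : red s = 0.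
  rewrite reduction_sum => [|i]; last by apply: in_integersM; apply: in_integersX.
  rewrite (eq_bigr (fun=> red y ^+ (p ^ r).-1)) => [|i _]; last first.
    rewrite (reductionM red_unram) ?reductionX //; try exact: in_integersX.
    by rewrite rxy -exprD subnK // -ltnS prednK ?expn_gt0 ?prime_gt0.
  rewrite sumr_const card_ord -mulr_natr natrX -reduction_nat.
  have -> : red p%:R = 0 by rewrite -[p%:R]mulr1 reduction_p_mul //; apply: (in_integers_nat 1).
  by rewrite expr0n eqn0Ngt r_gt0 mulr0.
case/(reduction_ker red_unram Os) => t Ot ->.
case: pxy => u Ou ->; exists (u * t); first exact: in_integersM.
by rewrite exprSr; ring.
Qed.

(** Completeness of O is derived from that of Z_p. Fix a lift w(a) of each a in F and rewrite the
    series, with carries, as one with digits w(f(n)). Grouping equal digits gives a finite sum of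
    w(a) times the p-adic integer that sums p^n over f(n) = a. *)
Lemma integers_complete (z : nat -> K) : (forall n, O (z n)) ->
  exists2 s, O s & forall N, pX_integers N (s - \sum_(n < N) p%:R ^+ n * z n).
Proof.
move=> Oz.
have /boolp.choice[w wP] : forall a : F, exists y, O y /\ red y = a.
  by move=> a; have [y Oy ry] := reduction_surj red_unram a; exists y.
have /boolp.choice[delta dP] : forall x, exists y,
    O x -> O y /\ x = w (red x) + p%:R * y.
  move=> x; have [Ox|nOx] := pselect (O x); last by exists 0.
  have [Ow rw] := wP (red x).
  have : red (x - w (red x)) = 0.
    by rewrite (reductionD red_unram) ?reductionN ?rw ?subrr //; apply: in_integersN.
  case/(reduction_ker red_unram) => [|y Oy e].
    by apply: in_integersD => //; apply: in_integersN.
  by exists y => _; rewrite -e addrC subrK.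
(* The carry into place n: z(n) + t(n) leaves the digit w(f(n)) and passes on t(n+1). *)
pose t := fix t n := if n is n.+1 then delta (z n + t n) else 0.
have Ot n : O (t n).
  elim: n => [|n IH]; first exact: (in_integers_nat 0).
  by have [] := dP (z n + t n) (in_integersD (Oz n) IH).
pose f n := red (z n + t n).
have tS n : z n + t n = w (f n) + p%:R * t n.+1.
  by have [_] := dP _ (in_integersD (Oz n) (Ot n)).
pose S g := \sum_(a : F) iota (padic_series p_pr (fun n => g n == a)) * w a.
have OS g : O (S g).
  by apply: in_integers_sum => a; apply: in_integersM; [apply: in_integers_of|case: (wP a)].
have S_recl g : S g = w (g 0%N) + p%:R * S (g \o succn).
  rewrite /S mulr_sumr.
  under eq_bigr do rewrite padic_series_recl rmorphD rmorphM /= !rmorph_nat mulrDl -mulrA.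
  rewrite big_split /=; congr (_ + _).
  rewrite (bigD1 (g 0%N)) //= eqxx mul1r big1 ?addr0 // => a.
  by rewrite eq_sym => /negPf ->; rewrite mul0r.
(* After N terms there remain p^N times the tail of the digit series, less the pending carry. *)
exists (S f) => // N; exists (S (fun n => f (N + n)%N) - t N).
  by apply: in_integersD => //; apply: in_integersN.
elim: N => [|N IH]; first by rewrite big_ord0 mul1r.
rewrite big_ord_recr /= opprD addrA IH S_recl addn0.
have -> : S ((fun n => f (N + n)%N) \o succn) = S (fun n => f (N.+1 + n)%N).
  by congr S; apply: boolp.funext => n /=; rewrite addnS.
have zN : z N = w (f N) + p%:R * t N.+1 - t N by rewrite -tS addrK.
rewrite -[delta _]/(t N.+1); move: (t N.+1) zN => u ->.
by rewrite exprSr; ring.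
Qed.

(** Teichmuller's construction: w is the limit of y^(q^n) for any integral lift y of a. *)
Lemma root_of_unity_lift a : a != 0 ->
  exists w, [/\ O w, w ^+ #|F|.-1 = 1 & red w = a].
Proof.
move=> a0; have [y Oy ry] := reduction_surj red_unram a.
set q := #|F|.
have q0 : (0 < q)%N by rewrite /q cardF expn_gt0 prime_gt0.
pose u n := y ^+ (q ^ n).
have Ou n : O (u n) by apply: in_integersX.
have uS n : u n.+1 = u n ^+ q by rewrite /u expnSr exprM.
have ru n : red (u n) = a.
  elim: n => [|n IH]; first by rewrite /u expr1.
  by rewrite uS reductionX // IH expf_card.
have pu n : pX_integers n (u n.+1 - u n).
  elim: n => [|n IH].
    exists (u 1%N - u 0%N); rewrite ?mul1r //.
    by apply: in_integersD => //; apply: in_integersN.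
  by rewrite (uS n.+1) {2}(uS n); apply: pX_integers_expq => //; rewrite !ru.
have /boolp.choice[z zP] : forall n, exists z, O z /\ u n.+1 - u n = p%:R ^+ n * z.
  by move=> n; have [z] := pu n; exists z.
have [s Os sP] := integers_complete (fun n => proj1 (zP n)).
pose w := y + s; have Ow : O w by apply: in_integersD.
have wu N : pX_integers N (w - u N).
  suff -> : w - u N = s - \sum_(n < N) p%:R ^+ n * z n by [].
  under eq_bigr do rewrite -(proj2 (zP _)).
  have -> : \sum_(n < N) (u n.+1 - u n) = u N - y.
    rewrite -(big_mkord xpredT (fun n => u n.+1 - u n)) -[y]/(u 0%N).
    exact: telescope_sumr.
  by rewrite /w; ring.
have rw : red w = a.
  have [v Ov] := wu 1%N; rewrite expr1 => e.
  have -> : w = u 1%N + p%:R * v by rewrite -e addrC subrK.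
  rewrite (reductionD red_unram) ?reduction_p_mul ?addr0 //.
  by apply: in_integersM => //; apply: in_integers_nat.
(* Both sides are limits of u(n), since u(n+1) = u(n)^q. *)
have wq : w ^+ q = w.
  apply/eqP; rewrite -subr_eq0; apply/eqP/pX_integers_separated => N.
  have -> : w ^+ q - w = (w ^+ q - u N ^+ q) + (u N.+1 - u N) - (w - u N).
    by rewrite uS; ring.
  apply: pX_integersD; last first.
    by rewrite -mulrN1; apply: pX_integersM (in_integersN (in_integers_nat 1)).
  apply: pX_integersD (pu N); rewrite subrXX; apply: pX_integersM (wu N) _.
  by apply: in_integers_sum => i; apply: in_integersM; apply: in_integersX.
exists w; split=> //.
have w0 : w != 0 by apply: contraNneq a0 => w0; rewrite -rw w0 reduction0.
by apply: (mulfI w0); rewrite -exprS prednK // wq mulr1.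
Qed.

(** If z = w/w' were not 1, then 1 + z + ... + z^(q-2) would vanish; but z reduces to 1, so this sum
    reduces to q - 1 = -1. *)
Lemma root_of_unity_lift_inj w w' : O w -> O w' ->
  w ^+ #|F|.-1 = 1 -> w' ^+ #|F|.-1 = 1 -> red w = red w' -> w = w'.
Proof.
move=> Ow Ow' w1 w1' rww.
have qE : #|F|.-1.+1 = (p ^ r)%N by rewrite cardF prednK // expn_gt0 prime_gt0.
have q0 : (0 < #|F|.-1)%N by rewrite -ltnS qE -(expn0 p) ltn_exp2l ?prime_gt1.
have w0' : w' != 0.
  by apply: contraTneq (oner_neq0 K) => w0; rewrite -w1' w0 expr0n eqn0Ngt q0 eqxx.
(* The inverse of a root of unity is one of its powers, hence integral. *)
have Ov : O (w'^-1).
  have -> : w'^-1 = w' ^+ #|F|.-1.-1.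
    by apply: (mulfI w0'); rewrite -exprS prednK // w1' divff.
  exact: in_integersX.
have Oz : O (w / w') by apply: in_integersM.
have rz : red (w / w') = 1.
  by rewrite (reductionM red_unram) // rww -(reductionM red_unram) // divff ?reduction1.
apply: (mulIf (invr_neq0 w0')); rewrite divff //; apply/eqP; rewrite -subr_eq0.
have : (w / w') ^+ #|F|.-1 - 1 == 0 by rewrite expr_div_n w1 w1' divr1 subrr.
rewrite subrX1 mulf_eq0 => /orP[//|/eqP/(congr1 red)].
rewrite reduction0 reduction_sum => [|i]; last exact: in_integersX.
rewrite (eq_bigr (fun=> 1)) => [|i _]; last by rewrite reductionX // rz expr1n.
rewrite sumr_const card_ord => e.
have : (#|F|.-1.+1)%:R = 0 :> F.
  rewrite qE natrX -reduction_nat.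
  have -> : red p%:R = 0 by rewrite -[p%:R]mulr1 reduction_p_mul //; apply: (in_integers_nat 1).
  by rewrite expr0n eqn0Ngt r_gt0.
by rewrite -natr1 e add0r => /eqP; rewrite oner_eq0.
Qed.

Lemma teichmullerP a : a != 0 ->
  [/\ O (teichmuller red a), teichmuller red a ^+ #|F|.-1 = 1 & red (teichmuller red a) = a].
Proof.
move=> /root_of_unity_lift lift; rewrite /teichmuller.
by case: xgetP => // none; case: lift => w /none.
Qed.

Lemma teichmuller_eq a w : O w -> w ^+ #|F|.-1 = 1 -> red w = a -> a != 0 ->
  teichmuller red a = w.
Proof.
by move=> Ow w1 rw /teichmullerP[Ot t1 rt]; apply: root_of_unity_lift_inj; rewrite ?rt.
Qed.

Lemma omega_barN j a : odd p ->
  omega_bar_pow red j (- a) = (-1) ^+ j * omega_bar_pow red j a.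
Proof.
move=> p_odd; rewrite /omega_bar_pow oppr_eq0; case: eqVneq => [_|a0]; first by rewrite mulr0.
have [Ot t1 rt] := teichmullerP a0.
(* As q - 1 is even, the negative is again a (q-1)-th root of unity. *)
have -> : teichmuller red (- a) = - teichmuller red a.
  apply: teichmuller_eq; rewrite ?oppr_eq0 ?reductionN ?rt //; first exact: in_integersN.
  rewrite exprNn t1 mulr1 -signr_odd.
  suff -> : odd #|F|.-1 = false by [].
  by apply: negbTE; rewrite -oddS cardF prednK ?expn_gt0 ?prime_gt0 // oddX p_odd orbT.
by rewrite invrN [LHS]exprNn.
Qed.

Lemma omega_bar_sqr j a :
  omega_bar_pow red j (a ^+ 2) = omega_bar_pow red (2 * j) a.
Proof.
rewrite /omega_bar_pow expf_eq0 /=; case: eqVneq => // a0.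
have [Ot t1 rt] := teichmullerP a0.
have -> : teichmuller red (a ^+ 2) = teichmuller red a ^+ 2.
  apply: teichmuller_eq; rewrite ?expf_eq0 //; first exact: in_integersX.
    by rewrite -exprM mulnC exprM t1 expr1n.
  by rewrite reductionX ?rt.
by rewrite exprM !exprVn.
Qed.

Lemma omega_barD j a :
  omega_bar_pow red (j + #|F|.-1) a = omega_bar_pow red j a.
Proof.
rewrite /omega_bar_pow; case: eqVneq => // a0; have [_ t1 _] := teichmullerP a0.
by rewrite exprD [in X in _ * X]exprVn t1 invr1 mulr1.
Qed.

End Teichmuller.

(** * Coefficients of the hypergeometric functions *)

Lemma frac_partDz (x : rat) (m : int) : frac_part (x + m%:~R) = frac_part x.
Proof. by rewrite /frac_part floorDrz ?intr_int // intrKfloor intrD opprD addrACA subrr addr0. Qed.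

Lemma floor_halves (z : rat) :
  Num.floor z + Num.floor (z + 2^-1) = Num.floor (2 * z).
Proof.
have /andP[zge zlt] := floor_itv z.
rewrite intrD in zlt.
set n := Num.floor z in zge zlt *.
case: (ltrP (z - n%:~R) 2^-1) => zn.
  rewrite (@floor_def _ (z + _) n); last by rewrite intrD; lra.
  by rewrite (@floor_def _ (2 * z) (n + n)) // !intrD; lra.
rewrite (@floor_def _ (z + _) (n + 1)); last by rewrite !intrD; lra.
by rewrite (@floor_def _ (2 * z) (n + (n + 1))) // !intrD; lra.
Qed.

(** The fractional parts of c and c + 1/2 are f/2 and (f+1)/2, in this order or swapped according to
    whether that of c is below 1/2. *)
Lemma frac_part_halves (T : comPzSemiRingType) (phi : rat -> T) (c : rat) :
  let f := frac_part (2 * c) in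
  phi (frac_part c) * phi (frac_part (c + 2^-1)) = phi (f / 2) * phi ((f + 1) / 2).
Proof.
rewrite /= /frac_part -floor_halves; have := floor_itv c; have := floor_itv (c + 2^-1).
rewrite !intrD; set n := Num.floor c; set m := Num.floor _ => cm cn.
have [-> | ->] : m = n \/ m = n + 1.
- have : (n%:~R < (m + 1)%:~R :> rat) && (m%:~R < (n + 2)%:~R :> rat).
    by rewrite !intrD; lra.
  by rewrite !ltr_int; lia.
- by congr (phi _ * phi _); field.
- by rewrite mulrC intrD; congr (phi _ * phi _); field.
Qed.

(** Hermite's identity at c - t minus the same identity at c. *)
Lemma floor_frac_halves (c t : rat) :
  Num.floor (frac_part c - t) + Num.floor (frac_part (c + 2^-1) - t) =
  Num.floor (frac_part (2 * c) - 2 * t).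
Proof.
have floorE x y : Num.floor (frac_part x - y) = Num.floor (x - y) - Num.floor x.
  by rewrite /frac_part addrAC -intrN floorDrz ?intr_int // intrKfloor.
rewrite !floorE -(floor_halves c) -mulrBr -(floor_halves (c - t)).
by rewrite [c + _ - t]addrAC; ring.
Qed.

Lemma odd_half (k : nat) : odd k -> k%:R / 2 = (k./2)%:Z%:~R + 2^-1 :> rat.
Proof.
move=> ko; rewrite -{1}(odd_double_half k) ko natrD -muln2 natrM.
by rewrite /= mulrDl mul1r mulfK // addrC.
Qed.

Lemma mul_factors (L : fieldType) (u u' x x' y y' z z' w w' : L) :
  u * (x / y) * (z / w) * (u' * (x' / y') * (z' / w')) =
  u * u' * (x * x' / (y * y')) * (z * z' / (w * w')).
Proof. by rewrite !invfM; ring. Qed.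

Section Coefficients.
Variables (p : nat) (p_pr : prime p) (p_odd : odd p) (r : nat) (r_gt0 : (0 < r)%N).
Local Notation Zp := (padic_int p_pr).
Variable (K : fieldExtType {fraction Zp}).
Let Q := (p ^ r).-1.
Implicit Types (a b : rat) (i j : nat).

Let Q_rat : (p ^ r)%N%:R - 1 = Q%:R :> rat.
Proof.
have pr0 : (0 < p ^ r)%N by rewrite expn_gt0 prime_gt0.
by rewrite -[in LHS](prednK pr0) -natr1 addrK.
Qed.

Definition G_exp a b i j : int :=
  let s : rat := j%:R * p%:R ^+ i / Q%:R in
  - Num.floor (frac_part (a * p%:R ^+ i) - s)
  - Num.floor (frac_part (- b * p%:R ^+ i) + s).

(* [G_factor] with phi in place of Gamma_p: the product of the factors at the
   parameters a/2 and (1 + a)/2 has this shape for phi = [gamma_pair]. *)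
Definition G_term (phi : rat -> K) a b i j : K :=
  let s : rat := j%:R / Q%:R in
  (- p%:R) ^ (G_exp a b i j)
  * (phi (frac_part ((a - s) * p%:R ^+ i)) / phi (frac_part (a * p%:R ^+ i)))
  * (phi (frac_part ((- b + s) * p%:R ^+ i)) / phi (frac_part (- b * p%:R ^+ i))).

Lemma G_factorE n (a b : n.-tuple rat) (k : 'I_n) i j :
  G_factor K r a b k i j = G_term (gamma_rat K) (tnth a k) (tnth b k) i j.
Proof. by rewrite /G_factor /G_exponent Q_rat. Qed.

Definition gamma_pair (x : rat) : K := gamma_rat K (x / 2) * gamma_rat K ((x + 1) / 2).

(** As p^i is odd, the arguments built from a/2 and (1+a)/2 differ by 1/2 modulo integers, and
    likewise for b. Each such pair combines into one value at the doubled argument, which turns s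
    into 2 s and hence j into 2 j. *)
Lemma G_term_halves a b i j :
  G_term (gamma_rat K) (a / 2) (b / 2) i j *
  G_term (gamma_rat K) ((1 + a) / 2) ((1 + b) / 2) i j =
  G_term gamma_pair a b i (2 * j).
Proof.
have podd : odd (p ^ i) by rewrite oddX p_odd orbT.
have fracD x y : x = y + p%:R ^+ i / 2 -> frac_part x = frac_part (y + 2^-1).
  by move=> ->; rewrite -natrX odd_half // addrCA [_%:~R + _]addrC frac_partDz.
have fracB x y : x = y - p%:R ^+ i / 2 -> frac_part x = frac_part (y + 2^-1).
  move=> ->; rewrite -natrX odd_half // opprD -intrN addrCA [_%:~R + _]addrC frac_partDz.
  (* Shifts by -1/2 and by 1/2 agree modulo integers. *)
  by rewrite -[in RHS](subrK 1 (y + _)) (frac_partDz _ 1); congr frac_part; field.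
rewrite /G_term; set P := p%:R ^+ i : rat; set s := j%:R / Q%:R : rat.
have s2 : (2 * j)%:R / Q%:R = 2 * s :> rat by rewrite natrM mulrA.
rewrite s2.
rewrite (fracD (((1 + a) / 2 - s) * P) ((a / 2 - s) * P)); last by rewrite /P; field.
rewrite (fracD (((1 + a) / 2) * P) ((a / 2) * P)); last by rewrite /P; field.
rewrite (fracB ((- ((1 + b) / 2) + s) * P) ((- (b / 2) + s) * P)); last by rewrite /P; field.
rewrite (fracB (- ((1 + b) / 2) * P) (- (b / 2) * P)); last by rewrite /P; field.
have pairE c d : 2 * c = d -> gamma_rat K (frac_part c) * gamma_rat K (frac_part (c + 2^-1)) =
    gamma_pair (frac_part d).
  by move=> <-; exact: frac_part_halves.
rewrite -(pairE ((a / 2 - s) * P)); last by field.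
rewrite -(pairE ((a / 2) * P)); last by field.
rewrite -(pairE ((- (b / 2) + s) * P)); last by field.
rewrite -(pairE (- (b / 2) * P)); last by field.
have -> : G_exp a b i (2 * j) = G_exp (a / 2) (b / 2) i j + G_exp ((1 + a) / 2) ((1 + b) / 2) i j.
  rewrite /G_exp -/P.
  rewrite (fracD (((1 + a) / 2) * P) ((a / 2) * P)); last by rewrite /P; field.
  rewrite (fracB (- ((1 + b) / 2) * P) (- (b / 2) * P)); last by rewrite /P; field.
  set t := j%:R * P / Q%:R.
  have -> : (2 * j)%:R * P / Q%:R = 2 * t by rewrite natrM /t !mulrA.
  have -> : a * P = 2 * (a / 2 * P) by field.
  have -> : - b * P = 2 * (- (b / 2) * P) by field.
  have := floor_frac_halves (- (b / 2) * P) (- t); rewrite mulrN !opprK => <-.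
  by rewrite -floor_frac_halves; ring.
rewrite (expfzDr (G_exp (a / 2) (b / 2) i j)) ?oppr_eq0 ?fieldext_p_neq0 //.
exact: mul_factors.
Qed.

Let Q_gt0 : (0 < Q)%N.
Proof. by rewrite /Q -subn1 subn_gt0 -(expn0 p) ltn_exp2l // prime_gt1. Qed.

(** Adding Q to j adds 1 to s: the two floors move by opposite amounts p^i, and the gamma arguments
    move by integers. *)
Lemma G_term_period a b i j :
  G_term (gamma_rat K) a b i (j + Q) = G_term (gamma_rat K) a b i j.
Proof.
have Q0 : (Q%:R : rat) != 0 by rewrite pnatr_eq0 -lt0n.
have sE (x : rat) : (j + Q)%:R * x / Q%:R = j%:R * x / Q%:R + x.
  by rewrite natrD mulrDl mulrDl [Q%:R * x]mulrC mulfK.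
have PE : (p%:R ^+ i : rat) = (p ^ i)%:Z%:~R by rewrite -natrX.
have expE : G_exp a b i (j + Q) = G_exp a b i j.
  have floorB (x t : rat) : Num.floor (x - (t + p%:R ^+ i)) = Num.floor (x - t) - (p ^ i)%:Z.
    by rewrite PE opprD addrA -intrN floorDrz ?intr_int // intrKfloor.
  have floorD (x t : rat) : Num.floor (x + (t + p%:R ^+ i)) = Num.floor (x + t) + (p ^ i)%:Z.
    by rewrite PE addrA floorDrz ?intr_int // intrKfloor.
  by rewrite /G_exp sE floorB floorD; ring.
have fracE x y m : x = y + m%:~R :> rat -> frac_part x = frac_part y.
  by move=> ->; rewrite frac_partDz.
rewrite /G_term expE; have := sE 1; rewrite !mulr1 => ->.
rewrite (fracE ((a - (j%:R / Q%:R + 1)) * p%:R ^+ i)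
  ((a - j%:R / Q%:R) * p%:R ^+ i) (- (p ^ i)%:Z)); last first.
  by rewrite intrN -PE; ring.
rewrite (fracE ((- b + (j%:R / Q%:R + 1)) * p%:R ^+ i)
  ((- b + j%:R / Q%:R) * p%:R ^+ i) (p ^ i)%:Z) //.
by rewrite -PE; ring.
Qed.

(** Over the denominator Q every gamma argument is indexed by an integer, so the product over i
    splits into values of g, the form [prod_gamma_pair] applies to. *)
Lemma prod_G_term (phi : rat -> K) (alpha beta : int) j
    (E := \sum_(0 <= i < r) G_exp (alpha%:~R / Q%:R) (beta%:~R / Q%:R) i j)
    (g := fun N : int => \prod_(i < r) phi (frac_part (N%:~R * p%:R ^+ i / Q%:R))) :
  \prod_(0 <= i < r) G_term phi (alpha%:~R / Q%:R) (beta%:~R / Q%:R) i j =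
  (- p%:R) ^ E * (g (alpha - j%:Z) / g alpha) * (g (- beta + j%:Z) / g (- beta)).
Proof.
rewrite !big_split /=; congr (_ * _ * _).
- have expD : {morph (fun e : int => (- p%:R : K) ^ e) : x y / x + y >-> x * y}.
    by move=> x y; rewrite expfzDr // oppr_eq0 fieldext_p_neq0.
  by rewrite /E (big_morph _ expD (expr0z _)).
- rewrite /g !big_mkord prodfV; congr (_ / _); apply: eq_bigr => i _; congr (phi (frac_part _)).
    by rewrite intrB -pmulrn; ring.
  by ring.
- rewrite /g !big_mkord prodfV; congr (_ / _); apply: eq_bigr => i _; congr (phi (frac_part _)).
    by rewrite intrD intrN -pmulrn; ring.
  by rewrite intrN; ring.
Qed.

Lemma prod_gamma_pair (N : int)
    (f := fun i => frac_part (N%:~R * p%:R ^+ i / Q%:R)) :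
  \prod_(i < r) gamma_pair (f i) =
  of_padic_int K (dup_ratio (0 : Zp) ^+ r) * of_padic_int K (dup_root p_pr) ^ N
    * \prod_(i < r) gamma_rat K (f i).
Proof.
transitivity (of_padic_int K (\prod_(i < r)
    (morita_gamma (ratr (f i / 2)) * morita_gamma (ratr ((f i + 1) / 2))))).
  by rewrite rmorph_prod; apply: eq_bigr => i _; rewrite rmorphM.
by rewrite (prod_gamma_dup p_pr p_odd r_gt0 N) 2!rmorphM rmorphXz ?dup_root_unit // rmorph_prod.
Qed.

(** The constants C cancel in each quotient, and the exponents of V add up to (alpha - j) - alpha +
    (-beta + j) + beta = 0. *)
Lemma prod_G_term_pair (alpha beta : int) (j : nat) :
  \prod_(0 <= i < r) G_term gamma_pair (alpha%:~R / Q%:R) (beta%:~R / Q%:R) i j =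
  \prod_(0 <= i < r) G_term (gamma_rat K) (alpha%:~R / Q%:R) (beta%:~R / Q%:R) i j.
Proof.
rewrite !prod_G_term !prod_gamma_pair.
set C := of_padic_int K (_ ^+ r); set V := of_padic_int K _.
have C0 : C != 0.
  by rewrite of_padic_int_eq0 expf_neq0 // padic_unit_neq0 // dup_ratio_unit.
have V0 : V != 0 by rewrite of_padic_int_eq0 padic_unit_neq0 // dup_root_unit.
have mulfC (u v g g' : K) : C * u * g / (C * v * g') = u / v * (g / g').
  have -> : C * u * g / (C * v * g') = C / C * (u / v * (g / g')) by rewrite !invfM; ring.
  by rewrite divff // mul1r.
have cancel (u v y g h : K) : u * v = 1 -> y * (u * g) * (v * h) = y * g * h.
  by move=> uv; rewrite -[RHS]mul1r -uv; ring.
rewrite !mulfC; apply: cancel.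
rewrite !expfzDr // [V ^ alpha * _]mulrC [V ^ (- beta) * _]mulrC !mulfK ?expfz_neq0 //.
by rewrite -expfzDr // addNr expr0z.
Qed.

End Coefficients.

(** * Comparison of the two character sums *)

Lemma sum_even_terms (L : comPzRingType) (G : nat -> L) (m : nat) :
  (forall j, G (j + m.*2)%N = G j) ->
  \sum_(0 <= j < m.*2) (1 + (-1) ^+ j) * G j = \sum_(0 <= j < m.*2) G (2 * j)%N.
Proof.
(* Doubling runs through the even residues mod 2m twice, once on each half of the range, matching
   the weight 2 of even j on the left. *)
move=> GP; rewrite -[in RHS]addnn [RHS](@big_cat_nat _ _ _ m) ?leq_addr //=.
have -> : \sum_(m <= j < m + m) G (2 * j)%N = \sum_(0 <= j < m) G (2 * j)%N.
  rewrite -{1}[m]add0n big_addn addnK; apply: eq_bigr => j _.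
  by rewrite mulnDr [(2 * m)%N]mul2n GP.
elim: {GP}m => [|m IH]; first by rewrite !big_geq // addr0.
rewrite doubleS !big_nat_recr //= IH exprS -signr_odd odd_double mul2n; ring.
Qed.

Theorem theorem1p1 (m1 m2 m3 m4 : int) (d1 d2 d3 d4 : nat)
  (d1_gt0 : (0 < d1)%N) (d2_gt0 : (0 < d2)%N)
  (d3_gt0 : (0 < d3)%N) (d4_gt0 : (0 < d4)%N)
  (co1 : coprime `|m1| d1) (co2 : coprime `|m2| d2)
  (co3 : coprime `|m3| d3) (co4 : coprime `|m4| d4)
  (p : nat) (p_pr : prime p) (p_odd : odd p)
  (p_ndvd : ~~ (p %| d1 * d2 * d3 * d4)%N)
  (r : nat) (r_gt0 : (0 < r)%N)
  (q_mod : (p ^ r = 1 %[mod lcmn (lcmn (lcmn d1 d2) d3) d4])%N)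
  (F : finFieldType) (cardF : #|F| = (p ^ r)%N)
  (K : fieldExtType {fraction (padic_int p_pr)})
  (red : K -> F) (red_unram : unramified_reduction red) (x : F) :
  let a1 : rat := m1%:~R / d1%:R in
  let a2 : rat := m2%:~R / d2%:R in
  let a3 : rat := m3%:~R / d3%:R in
  let a4 : rat := m4%:~R / d4%:R in
  mccarthy_G red r [tuple a1; a2] [tuple a3; a4] x
  + mccarthy_G red r [tuple a1; a2] [tuple a3; a4] (- x)
  = mccarthy_G red r
      [tuple a1 / 2; (1 + a1) / 2; a2 / 2; (1 + a2) / 2]
      [tuple a3 / 2; (1 + a3) / 2; a4 / 2; (1 + a4) / 2] (x ^+ 2).
Proof.
move=> a1 a2 a3 a4.
have q_gt0 : (0 < p ^ r)%N by rewrite expn_gt0 prime_gt0.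
pose Q := (p ^ r).-1; have QE : #|F|.-1 = Q by rewrite cardF.
have dvdQ : (lcmn (lcmn (lcmn d1 d2) d3) d4 %| Q)%N.
  by move/eqP: q_mod; rewrite eqn_mod_dvd // subn1.
move: dvdQ; rewrite !dvdn_lcm => /andP[/andP[/andP[d1Q d2Q] d3Q] d4Q].
have Q_gt0 : (0 < Q)%N by rewrite /Q -subn1 subn_gt0 -(expn0 p) ltn_exp2l // prime_gt1.
(* The congruence on q makes q - 1 a common denominator of the four parameters. *)
have fracQ (m : int) (d : nat) : (0 < d)%N -> (d %| Q)%N ->
    exists c : int, m%:~R / d%:R = c%:~R / Q%:R :> rat.
  move=> d_gt0 /dvdnP[k Qk]; exists (m * k%:Z); rewrite Qk natrM intrM -pmulrn invfM.
  have k0 : (k%:R : rat) != 0.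
    by rewrite pnatr_eq0; apply: contraTneq Q_gt0 => k0; rewrite Qk k0.
  by rewrite -mulrA mulVKf.
have [c1 c1E] : exists c1 : int, a1 = c1%:~R / Q%:R := fracQ _ _ d1_gt0 d1Q.
have [c2 c2E] : exists c2 : int, a2 = c2%:~R / Q%:R := fracQ _ _ d2_gt0 d2Q.
have [c3 c3E] : exists c3 : int, a3 = c3%:~R / Q%:R := fracQ _ _ d3_gt0 d3Q.
have [c4 c4E] : exists c4 : int, a4 = c4%:~R / Q%:R := fracQ _ _ d4_gt0 d4Q.
pose A a b j := \prod_(0 <= i < r) G_term r (gamma_rat K) a b i j.
have A_half a b (ca cb : int) j : a = ca%:~R / Q%:R -> b = cb%:~R / Q%:R ->
    A (a / 2) (b / 2) j * A ((1 + a) / 2) ((1 + b) / 2) j = A a b (2 * j)%N.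
  move=> aE bE; rewrite /A -big_split /=.
  under eq_bigr do rewrite G_term_halves //.
  by rewrite aE bE prod_G_term_pair.
pose G j := omega_bar_pow red j x * (A a1 a3 j * A a2 a4 j).
have [m mE] : exists m, Q = m.*2.
  exists Q./2; rewrite -[LHS]odd_double_half; suff -> : odd Q = false by [].
  by apply: negbTE; rewrite -oddS prednK // oddX p_odd orbT.
have GP j : G (j + m.*2)%N = G j.
  have AP a b : A a b (j + Q)%N = A a b j by apply: eq_bigr => i _; apply: G_term_period.
  by rewrite /G -mE !AP -{1}QE (omega_barD red_unram r_gt0 cardF).
have even_sign j n : (-1) ^+ (j * n.*2) = 1 :> K by rewrite -signr_odd oddM odd_double andbF.
have prodE n (a b : n.-tuple rat) j :
    \prod_(k < n) \prod_(0 <= i < r) G_factor K r a b k i j =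
    \prod_(k < n) A (tnth a k) (tnth b k) j.
  by apply: eq_bigr => k _; apply: eq_bigr => i _; apply: G_factorE.
rewrite /mccarthy_G -mulrDr; congr (_ * _).
rewrite -big_split /= -[(p ^ r).-1]/Q mE.
(* The signs (-1)^(jn) are trivial for n = 2 and n = 4; the factor (-1)^j comes from the argument
   -x. *)
transitivity (\sum_(0 <= j < m.*2) (1 + (-1) ^+ j) * G j).
  apply: eq_bigr => j _; rewrite (even_sign j 1%N) prodE !big_ord_recl big_ord0.
  rewrite (omega_barN red_unram r_gt0 cardF) //.
  by rewrite /G !mulr1 !mul1r; ring.
rewrite (sum_even_terms GP); apply: eq_bigr => j _.
rewrite (even_sign j 2%N) mul1r (omega_bar_sqr red_unram r_gt0 cardF) /G; congr (_ * _).
rewrite -(A_half _ _ _ _ _ c1E c3E) -(A_half _ _ _ _ _ c2E c4E).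
by rewrite prodE !big_ord_recl big_ord0 mulr1 !mulrA.
Qed.
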